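(* Let $W$ and $Y$ be positive random variables satisfying $$Y \succeq W_0 Y_0 + W_1 Y_1,$$ where $Y_0, Y_1$ are independent random variables each with the same distribution as $Y$, the pair $(Y_0,Y_1)$ is independent of the pair $(W_0,W_1)$, and $W_0$ and $W_1$ each have the same distribution as $W$ ($W_0$ and $W_1$ are not assumed to be independent of each other). Suppose further that there exist $\gamma > 1$, $c > 0$ and $x' \in (0,1)$ such that $$\mathbb{P}(W \leq x) \leq \exp\left( - c (-\log x)^\gamma \right) \quad \text{for all } 0 < x \leq x'.$$ Then for every $\alpha \in [1,\gamma)$ there exist constants $t_\alpha \geq 1$ and $c_\alpha > 0$ such that $$\mathbb{E}\, e^{-t Y} \leq \exp\left(- c_\alpha (\log t)^\alpha \right) \quad \text{for all } t \geq t_\alpha.$$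
   Context: A random variable $X$ is called positive if $\mathbb{P}(X>0)=1$. For real random variables, $X \preceq Z$ (equivalently $Z \succeq X$) means that $X$ is stochastically dominated by $Z$, i.e. $\mathbb{P}(X \geq x) \leq \mathbb{P}(Z \geq x)$ for all $x \in \mathbb{R}$. *)

(* Defs.v *)
From HB Require Import structures.
From mathcomp Require Import all_boot all_order all_algebra.
From mathcomp Require Import all_classical all_reals all_analysis.
Set Implicit Arguments.
Unset Strict Implicit.
Unset Printing Implicit Defensive.
Import Order.TTheory GRing.Theory Num.Theory.
Import numFieldNormedType.Exports.
Local Open Scope classical_set_scope.
Local Open Scope ring_scope.

Definition positive_rv d (T : measurableType d) (R : realType)
    (P : probability T R) (X : {RV P >-> R}) : Prop :=
  P [set w | 0 < X w] = 1%E.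

(** The two random variables may live on different probability spaces: only
    their laws are compared, here and in [stoch_le]. *)
Definition same_distribution d1 d2 d' (T1 : measurableType d1)
    (T2 : measurableType d2) (T' : measurableType d') (R : realType)
    (P : probability T1 R) (Q : probability T2 R)
    (X : {RV P >-> T'}) (Z : {RV Q >-> T'}) : Prop :=
  forall A : set T', measurable A -> distribution P X A = distribution Q Z A.

Definition stoch_le d1 d2 (T1 : measurableType d1) (T2 : measurableType d2)
    (R : realType) (P : probability T1 R) (Q : probability T2 R)
    (X : T1 -> R) (Z : T2 -> R) : Prop :=
  forall x : R, (P [set w | (x <= X w)%R] <= Q [set w | (x <= Z w)%R])%E.

(** As in [stoch_le], [X] and [Z] are plain functions, so that combinations of
    random variables such as [fun w => (Y0 w, Y1 w)] can be used as is; the product type carries the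
    product sigma-algebra. *)
Definition independent_rv d d1 d2 (T : measurableType d)
    (T1 : measurableType d1) (T2 : measurableType d2) (R : realType)
    (P : probability T R) (X : T -> T1) (Z : T -> T2) : Prop :=
  forall (A : set T1) (B : set T2), measurable A -> measurable B ->
    P ((X @^-1` A) `&` (Z @^-1` B)) = (P (X @^-1` A) * P (Z @^-1` B))%E.

(* Main.v *)
(** If [W0 Y0 + W1 Y1 < a b] with all four variables positive, then [W0 <= a],
    or [W1 <= a], or both [Y0 < b] and [Y1 < b].  Hence the small-ball
    probabilities [f s = P(Y < e^-s)] satisfy
    [f (u + s) <= 2 exp (- c u^gamma) + (f s)^2].  With [th = 2^(-1/gamma)] and
    [u = (1 - th) s], squaring [exp (- b (th s)^gamma)] gives exactly
    [exp (- b s^gamma)], so the decay [f s <= exp (- b s^gamma) / 2] propagates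
    from [th s] to [s].  The Laplace transform is recovered from
    [E e^(-t Y) <= P(Y < x) + e^(-t x)] at [x = t^(-1/2)].  The exponent [gamma]
    itself is reached, a fortiori every [alpha < gamma]. *)
Require Import Defs.
From HB Require Import structures.
From mathcomp Require Import all_boot all_order all_algebra.
From mathcomp Require Import all_classical all_reals all_analysis.
From mathcomp Require Import measurable_realfun ring lra.
Set Implicit Arguments.
Unset Strict Implicit.
Unset Printing Implicit Defensive.
Import Order.TTheory GRing.Theory Num.Theory.
Import numFieldNormedType.Exports.
Local Open Scope classical_set_scope.
Local Open Scope ring_scope.

(** * Real analysis: solving the quadratic recursion *)

(** Take [ln y < y] at [y = s / g] and multiply by [g]. *)
Lemma powR_le_expR (R : realType) (g s : R) : 0 < g -> 0 < s ->
  s `^ g <= g `^ g * expR s.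
Proof.
move=> g0 s0.
rewrite /powR (gt_eqF g0) (gt_eqF s0) -expRD ler_expR.
have sg0 : 0 < s / g by rewrite divr_gt0.
have := ln_sublinear sg0; rewrite ln_div ?posrE// => /ltW h.
have -> : s = g * (s / g) by field; rewrite gt_eqF.
rewrite -mulrDr (_ : g * (s / g) = s); last by field; rewrite gt_eqF.
rewrite ler_pM2l//; lra.
Qed.

Lemma decay_of_quadratic_recursion (R : realType) (f : R -> R) (g c u0 s0 : R) :
    0 < g -> 0 < c -> (forall s, 0 <= f s) -> {homo f : s t /~ s <= t} ->
    f s0 <= 4^-1 ->
    (forall s u : R, 0 < u -> u0 <= u ->
      f (u + s) <= 2 * expR (- c * u `^ g) + f s ^+ 2) ->
  exists S b, [/\ 0 < S, 0 < b &
    forall s, S <= s -> f s <= 2^-1 * expR (- b * s `^ g)].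
Proof.
move=> g0 c0 f0 fle fs0 frec.
have gn0 : g != 0 by rewrite gt_eqF.
pose th : R := 2 `^ (- g^-1).
have th0 : 0 < th by rewrite powR_gt0.
have thg : th `^ g = 2^-1.
  by rewrite /th -powRrM mulNr mulVf// powR_inv1.
have th1 : th < 1.
  rewrite ltNge; apply/negP => th1.
  have : 1 `^ g <= th `^ g by rewrite ge0_ler_powR ?nnegrE // ltW.
  by rewrite powR1 thg leNgt invf_lt1 ?ltr1n.
pose c' := c * (1 - th) `^ g.
have c'0 : 0 < c' by rewrite mulr_gt0// powR_gt0// subr_gt0.
pose S := Num.max (Num.max 1 s0) (Num.max (u0 / (1 - th)) ((6 / c') `^ g^-1)).
have S1 : 1 <= S by rewrite !le_max lexx.
have S0 : 0 < S by apply: lt_le_trans S1.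
have s0S : s0 <= S by rewrite !le_max lexx orbT.
have u0S : u0 <= (1 - th) * S.
  by rewrite mulrC -ler_pdivrMr ?subr_gt0// !le_max lexx !orbT.
have Sg : 6 / c' <= S `^ g.
  have c6 : 0 <= 6 / c' by rewrite divr_ge0// ltW.
  rewrite -[leLHS](powRr1 c6) -[X in _ `^ X <= _](mulVf gn0) powRrM.
  apply: ge0_ler_powR; rewrite ?nnegrE ?powR_ge0 ?(ltW g0) ?(ltW S0)//.
  by rewrite /S !le_max lexx !orbT.
have Sg0 : 0 < S `^ g by rewrite powR_gt0.
pose b := Num.min (c' / 2) (4^-1 / S `^ g).
have b0 : 0 < b by rewrite lt_min !divr_gt0// invr_gt0.
have bc : b <= c' / 2 by rewrite ge_min lexx.
have bS : b * S `^ g <= 4^-1 by rewrite -ler_pdivlMr// ge_min lexx orbT.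
exists S, b; split => // s Ss.
(* Induction on the number of halvings of [s `^ g], i.e. of multiplications
   of [s] by [th], needed to come down to [2 * S `^ g]. *)
have [n] : exists n : nat, s `^ g <= S `^ g * 2 ^+ n.+1.
  exists (Num.bound (s `^ g / S `^ g)).
  rewrite mulrC -ler_pdivrMr//.
  apply: (le_trans (ltW (archi_boundP _))).
    by rewrite divr_ge0// powR_ge0.
  by rewrite -natrX ler_nat; apply/ltnW/(ltn_trans (ltnSn _))/ltn_expl.
elim: n s Ss => [|n IH] s Ss sn.
  apply: (le_trans (fle _ _ (le_trans s0S Ss))); apply: (le_trans fs0).
  have := expR_ge1Dx (- b * s `^ g).
  have : b * s `^ g <= 2^-1.
    by apply: (le_trans (ler_wpM2l (ltW b0) sn)); rewrite expr1; lra.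
  lra.
have s_gt0 : 0 < s by apply: lt_le_trans Ss.
have [sn'|sn'] := leP (s `^ g) (S `^ g * 2 ^+ n.+1); first exact: IH.
have thsg : (th * s) `^ g = s `^ g / 2 by rewrite powRM ?ltW// thg mulrC.
(* By [sn'], [s]^ g[exceeds]2 * S [^ g], so one multiplication by [th] does not go below [S]. *)
have Sths : S <= th * s.
  rewrite leNgt; apply/negP => /ltW thsS.
  have : (th * s) `^ g <= S `^ g.
    by rewrite ge0_ler_powR ?nnegrE ?mulr_ge0 // ltW.
  rewrite thsg; move: sn'; rewrite exprS.
  have : 1 <= 2 ^+ n :> R by rewrite exprn_ege1// ler1n.
  nra.
have /(IH _ Sths) : (th * s) `^ g <= S `^ g * 2 ^+ n.+1.
  by rewrite thsg ler_pdivrMr// -mulrA -exprSr.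
rewrite thsg => fths.
have us : u0 <= (1 - th) * s.
  by apply: (le_trans u0S); rewrite ler_wpM2l// subr_ge0 ltW.
have us0 : 0 < (1 - th) * s by rewrite mulr_gt0// subr_gt0.
have := frec (th * s) _ us0 us.
rewrite -mulrDl subrK mul1r powRM ?subr_ge0 ?(ltW th1) ?(ltW s_gt0)//.
rewrite mulrA mulNr -/c' => /le_trans; apply.
have sg6 : 6 / c' <= s `^ g.
  by apply: (le_trans Sg); rewrite ge0_ler_powR ?nnegrE // ltW.
have {}sg6 : 6 <= c' * s `^ g by rewrite mulrC -ler_pdivrMr.
set E := expR (- b * s `^ g).
have E0 : 0 < E by exact: expR_gt0.
have f2 : f (th * s) ^+ 2 <= 4^-1 * E.
  have -> : E = expR (- b * (s `^ g / 2)) ^+ 2.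
    by rewrite -expRM_natl; congr expR; rewrite mulrA; field.
  apply: le_trans (_ : (2^-1 * expR (- b * (s `^ g / 2))) ^+ 2 <= _).
    by rewrite lerXn2r ?nnegrE ?mulr_ge0 ?expR_ge0.
  by rewrite exprMn (_ : 2^-1 ^+ 2 = 4^-1) //; field.
(* Half of [c' * s]^ g[is at least 3 and the other half at least]b * s [^ g]; moreover [e >= 2]
   gives [expR (- 3) <= 1/8]. *)
have q2 : expR (- c' * s `^ g) <= 8^-1 * E.
  have e3 : expR (- 3) <= 8^-1 :> R.
    rewrite expRN lef_pV2 ?posrE ?expR_gt0//.
    have -> : 3 = 3%:R * 1 :> R by rewrite mulr1.
    rewrite expRM_natl.
    have -> : 8 = 2 ^+ 3 :> R by rewrite -natrX.
    by rewrite lerXn2r ?nnegrE ?expR_ge0//; exact: (expR_ge1Dx (1 : R)).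
  apply: le_trans (_ : expR (- 3) * E <= _); last by rewrite ler_wpM2r// ltW.
  rewrite -expRD ler_expR.
  have : b * s `^ g <= c' / 2 * s `^ g by rewrite ler_wpM2r ?powR_ge0.
  lra.
lra.
Qed.

(** * Probability: small balls and the Laplace transform *)

Lemma measurable_rv_lt d (T : measurableType d) (R : realType)
    (P : probability T R) (X : {RV P >-> R}) (x : R) :
  measurable [set w | X w < x].
Proof.
rewrite (_ : [set w | _] = X @^-1` `]-oo, x[); first exact: measurable_funPTI.
by apply/seteqP; split => w /=; rewrite in_itv.
Qed.

Lemma measurable_rv_le d (T : measurableType d) (R : realType)
    (P : probability T R) (X : {RV P >-> R}) (x : R) :
  measurable [set w | X w <= x].
Proof.
rewrite (_ : [set w | _] = X @^-1` `]-oo, x]); first exact: measurable_funPTI.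
by apply/seteqP; split => w /=; rewrite in_itv.
Qed.

Lemma positive_rv_le0 d (T : measurableType d) (R : realType)
    (P : probability T R) (X : {RV P >-> R}) :
  positive_rv X -> P [set w | X w <= 0] = 0%E.
Proof.
move=> Xpos; have mX := measurable_rv_le X 0.
have -> : [set w | X w <= 0] = ~` [set w | 0 < X w].
  by apply/seteqP; split => w /=; rewrite leNgt => /negP.
rewrite probability_setC ?Xpos ?subee//.
rewrite (_ : [set w | 0 < X w] = ~` [set w | X w <= 0]).
  exact: measurableC.
by apply/seteqP; split => w /=; rewrite ltNge => /negP.
Qed.

(** The distribution function vanishes at 0 and is right-continuous there. This provides the
    starting value 1/4 of the recursion. *)
Lemma positive_rv_small_ball d (T : measurableType d) (R : realType)
    (P : probability T R) (X : {RV P >-> R}) (e : R) :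
  positive_rv X -> 0 < e ->
  exists2 x : R, 0 < x & (P [set w | (X w < x)%R] < e%:E)%E.
Proof.
move=> /positive_rv_le0 X0 e0.
have cdfE x : cdf X x = P [set w | X w <= x].
  by rewrite /cdf/= /distribution/= /pushforward/= set_itvE.
have cdf0 : cdf X x @[x --> 0^'+] --> 0%E.
  by have := @cdf_right_continuous _ _ _ _ X 0; rewrite cdfE X0.
have cdf_lt : \forall x \near 0^'+, (cdf X x < e%:E)%E.
  apply: (cdf0 (fun u => (u < e%:E)%E)).
  by apply: open_ereal_lt'; rewrite lte_fin.
have [x [x0 xe]] : exists x : R, 0 < x /\ (cdf X x < e%:E)%E.
  near (0 : R)^'+ => x; exists x; split.
    by near: x; exact: nbhs_right_gt.
  by near: x.
exists x => //; apply: le_lt_trans xe; rewrite cdfE.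
apply: le_measure; rewrite ?inE.
- exact: measurable_rv_lt.
- exact: measurable_rv_le.
by move=> w /= /ltW.
Unshelve. all: by end_near. Qed.

Lemma laplace_le_small_ball d (T : measurableType d) (R : realType)
    (P : probability T R) (X : {RV P >-> R}) (t x : R) :
  positive_rv X -> 0 <= t ->
  ('E_P[(fun w => expR (- t * X w))%R] <=
   P [set w | (X w < x)%R] + (expR (- t * x))%:E)%E.
Proof.
move=> Xpos t0; have mX := measurable_rv_lt X x.
rewrite -(expectation_indic P mX) -(expectation_cst P (expR (- t * x))).
rewrite [X in (_ <= X)%E](_ : _ =
  'E_P[\1_[set w | (X w < x)%R] \+ cst (expR (- t * x))%R])%E; last first.
  rewrite unlock -ge0_integralD//=.
  exact/measurable_EFinP/measurable_indic.
apply: expectation_le.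
- apply: measurableT_comp; first exact: measurable_expR.
  exact: measurable_funM.
- exact: measurable_funD.
- by move=> w; rewrite expR_ge0.
- by move=> w /=; rewrite addr_ge0// expR_ge0.
(* The pointwise bound is proved off this null set: for [X w > 0] the integrand is at most 1, and
   for [x <= X w] at most [expR (- t * x)]. *)
- exists [set w | X w <= 0].
  split; [exact: measurable_rv_le|exact: positive_rv_le0|].
  move=> w /= /negP; rewrite -ltNge => Xt.
  rewrite leNgt; apply/negP => Xw; move: Xt; apply/negP; rewrite -leNgt.
  have [Xx|xX] := ltP (X w) x.
    rewrite indicE mem_set//.
    apply: (@le_trans _ _ 1); last by rewrite lerDl expR_ge0.
    by rewrite -expR0 ler_expR mulNr oppr_le0 mulr_ge0// ltW.
  rewrite indicE memNset/=; last by apply/negP; rewrite -leNgt.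
  by rewrite add0r ler_expR !mulNr lerN2 ler_wpM2l.
Qed.

(** [W0] and [W1] are handled by a union bound; independence of [Y0] and [Y1] produces the
    square. *)
Lemma small_ball_recursion (R : realType)
  (dW dY d : measure_display)
  (TW : measurableType dW) (PW : probability TW R) (W : {RV PW >-> R})
  (TY : measurableType dY) (PY : probability TY R) (Y : {RV PY >-> R})
  (T : measurableType d) (P : probability T R)
  (W0 W1 Y0 Y1 : {RV P >-> R}) (a b : R) :
  positive_rv Y -> same_distribution W0 W -> same_distribution W1 W ->
  same_distribution Y0 Y -> same_distribution Y1 Y ->
  independent_rv P Y0 Y1 ->
  stoch_le P PY (fun w => W0 w * Y0 w + W1 w * Y1 w) Y ->
  0 < a ->
  (PY [set w | (Y w < a * b)%R] <=
    (PW [set w | (W w <= a)%R] + PW [set w | (W w <= a)%R]) +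
    PY [set w | (Y w < b)%R] * PY [set w | (Y w < b)%R])%E.
Proof.
move=> Ypos W0W W1W Y0Y Y1Y indep dom a0.
have Wle (V : {RV P >-> R}) : same_distribution V W ->
    (P [set w | (V w <= a)%R] <= PW [set w | (W w <= a)%R])%E.
  move=> /(_ `]-oo, a]%classic (measurable_itv _)).
  by rewrite /distribution/= /pushforward/= !set_itvE => ->.
have Ylt (V : {RV P >-> R}) : same_distribution V Y ->
    P [set w | V w < b] = PY [set w | Y w < b].
  move=> /(_ `]-oo, b[%classic (measurable_itv _)).
  by rewrite /distribution/= /pushforward/= !set_itvE.
have Yle (V : {RV P >-> R}) : same_distribution V Y ->
    P [set w | V w <= 0] = 0%E.
  move=> /(_ `]-oo, 0]%classic (measurable_itv _)).
  rewrite /distribution/= /pushforward/= !set_itvE => ->.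
  exact: positive_rv_le0.
pose Z w := W0 w * Y0 w + W1 w * Y1 w.
have mZ : measurable_fun setT Z.
  by apply: measurable_funD; apply: measurable_funM.
have mZlt : measurable [set w | Z w < a * b].
  rewrite -[X in measurable X]setTI (_ : [set w | _] = Z @^-1` `]-oo, (a * b)[).
    exact: mZ.
  by apply/seteqP; split => w /=; rewrite in_itv.
have YZ : (PY [set w | (Y w < a * b)%R] <= P [set w | (Z w < a * b)%R])%E.
  (* Domination compares upper tails; taking complements turns it into a comparison of the events
     below [a * b]. *)
  have := dom (a * b); rewrite -/Z.
  have -> : [set w | a * b <= Z w] = ~` [set w | Z w < a * b].
    by apply/seteqP; split => w /=; rewrite leNgt => /negP.
  have -> : [set w | a * b <= Y w] = ~` [set w | Y w < a * b].
    by apply/seteqP; split => w /=; rewrite leNgt => /negP.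
  rewrite (probability_setC _ mZlt) (probability_setC _ (measurable_rv_lt Y _)).
  rewrite -(fineK (fin_num_measure P _ mZlt)).
  rewrite -(fineK (fin_num_measure PY _ (measurable_rv_lt Y _))).
  by rewrite -!EFinB !lee_fin; lra.
pose A := [set w | Y0 w < b] `&` [set w | Y1 w < b].
have PA : (P A <=
    PY [set w | (Y w < b)%R] * PY [set w | (Y w < b)%R])%E.
  rewrite -{1}(Ylt _ Y0Y) -(Ylt _ Y1Y) /A.
  have mb : measurable (`]-oo, b[%classic : set R) by exact: measurable_itv.
  by have := indep _ _ mb mb; rewrite !set_itvE => ->.
have mle (V : {RV P >-> R}) x := measurable_rv_le V x.
have mlt (V : {RV P >-> R}) x := measurable_rv_lt V x.
apply: (le_trans YZ).
(* Off the null set [N], if both [W0] and [W1] exceed [a], the two summands of [Z] are positive and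
   each [a * Yi] is below [a * b]. *)
pose N := [set w | Y0 w <= 0] `|` [set w | Y1 w <= 0].
have mN : measurable N by exact: measurableU.
have N0 : P N = 0%E.
  rewrite /N measureU0; first exact: (Yle _ Y0Y).
  - exact: mle.
  - exact: mle.
  - exact: (Yle _ Y1Y).
have mA : measurable A by exact: measurableI.
pose B := [set w | W0 w <= a] `|` [set w | W1 w <= a].
have mB : measurable B by exact: measurableU.
apply: le_trans (_ : P ((B `|` A) `|` N) <= _)%E.
  apply: le_measure; rewrite ?inE//; first by do 2 apply: measurableU.
  move=> w /= Zw.
  have [Y0w|Y0w] := leP (Y0 w) 0; first by right; left.
  have [Y1w|Y1w] := leP (Y1 w) 0; first by right; right.
  have [W0w|W0w] := leP (W0 w) a; first by left; left; left.
  have [W1w|W1w] := leP (W1 w) a; first by left; left; right.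
  left; right; rewrite /A/=.
  have h0 : a * Y0 w <= W0 w * Y0 w by rewrite ler_wpM2r// ltW.
  have h1 : a * Y1 w <= W1 w * Y1 w by rewrite ler_wpM2r// ltW.
  have p0 : 0 < a * Y0 w by rewrite mulr_gt0.
  have p1 : 0 < a * Y1 w by rewrite mulr_gt0.
  by move: Zw; rewrite /Z => Zw; split; rewrite -(ltr_pM2l a0); lra.
rewrite measureU0//; last exact: measurableU.
apply: (le_trans (measureU2 _ mB mA)); apply: leeD; last exact: PA.
apply: (le_trans (measureU2 _ (mle W0 a) (mle W1 a))).
by apply: leeD; exact: Wle.
Qed.

(** * From small balls to the Laplace transform *)

Theorem theorem1 (R : realType)
  (dW dY d : measure_display)
  (TW : measurableType dW) (PW : probability TW R) (W : {RV PW >-> R})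
  (TY : measurableType dY) (PY : probability TY R) (Y : {RV PY >-> R})
  (T : measurableType d) (P : probability T R)
  (W0 W1 Y0 Y1 : {RV P >-> R})
  (W_pos : positive_rv W) (Y_pos : positive_rv Y)
  (W0_law : same_distribution W0 W) (W1_law : same_distribution W1 W)
  (Y0_law : same_distribution Y0 Y) (Y1_law : same_distribution Y1 Y)
  (indep_Y : independent_rv P Y0 Y1)
  (indep_YW : independent_rv P (fun w => (Y0 w, Y1 w)) (fun w => (W0 w, W1 w)))
  (dom : stoch_le P PY (fun w => W0 w * Y0 w + W1 w * Y1 w) Y)
  (gamma c x' : R) (gamma_gt1 : 1 < gamma) (c_gt0 : 0 < c)
  (x'_gt0 : 0 < x') (x'_lt1 : x' < 1)
  (W_tail : forall x : R, 0 < x -> x <= x' ->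
    (PW [set w | (W w <= x)%R] <= (expR (- c * (- ln x) `^ gamma))%:E)%E) :
  forall alpha : R, 1 <= alpha -> alpha < gamma ->
  exists t_alpha c_alpha : R, [/\ 1 <= t_alpha, 0 < c_alpha &
    forall t : R, t_alpha <= t ->
      ('E_PY[(fun w => expR (- t * Y w))%R]
         <= (expR (- c_alpha * (ln t) `^ alpha))%:E)%E].
Proof.
move=> alpha alpha1 alpha_gamma.
have gamma0 : 0 < gamma by exact: lt_trans gamma_gt1.
(* On the logarithmic scale the product [a * b] becomes the sum [u + s]. *)
pose f s := fine (PY [set w | Y w < expR (- s)]).
have fE s : (f s)%:E = PY [set w | Y w < expR (- s)].
  by rewrite fineK// fin_num_measure//; exact: measurable_rv_lt.
have [x x0 Yx] : exists2 x : R,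
    0 < x & (PY [set w | (Y w < x)%R] < (4^-1)%:E)%E.
  by apply: positive_rv_small_ball => //; rewrite invr_gt0.
have [S [b [S0 b0 fS]]] : exists S b, [/\ 0 < S, 0 < b &
    forall s, S <= s -> f s <= 2^-1 * expR (- b * s `^ gamma)].
  (* [u >= - ln x'] means [expR (- u) <= x'], the range of [W_tail]; at [s = - ln x] the small ball
     has radius [x]. *)
  apply: (@decay_of_quadratic_recursion _ _ _ c (- ln x') (- ln x)) => //.
  - by move=> s; rewrite fine_ge0.
  - move=> s t st; rewrite -lee_fin !fE.
    apply: le_measure; rewrite ?inE; [exact: measurable_rv_lt..|].
    by move=> w /= /lt_le_trans; apply; rewrite ler_expR lerN2.
  - by rewrite -lee_fin fE opprK lnK ?posrE// ltW.
  - move=> s u u0 x'u; rewrite -lee_fin.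
    have := small_ball_recursion (expR (- s)) Y_pos W0_law W1_law Y0_law Y1_law
      indep_Y dom (expR_gt0 (- u)).
    rewrite -expRD -opprD -!fE => /le_trans; apply.
    rewrite EFinD; apply: leeD; last by rewrite expr2 EFinM.
    rewrite mulr_natl mulr2n EFinD.
    have : expR (- u) <= x' by rewrite -[leRHS]lnK ?posrE// ler_expR lerNl.
    by move=> /(W_tail _ (expR_gt0 _)); rewrite expRK opprK => h; exact: leeD.
pose b' := Num.min b (2^-1 / gamma `^ gamma).
have gg0 : 0 < gamma `^ gamma by rewrite powR_gt0.
have b'0 : 0 < b' by rewrite lt_min b0 divr_gt0// invr_gt0.
pose c' := b' * 2^-1 `^ gamma.
have c'0 : 0 < c' by rewrite mulr_gt0// powR_gt0 invr_gt0.
(* This threshold gives [s >= S] and [s >= 1]; then [ln t >= 1], so exponent [alpha] may replace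
   [gamma]. *)
exists (expR (2 * Num.max 1 S)), c'; split=> //.
  by rewrite -[leLHS]expR0 ler_expR mulr_ge0// le_max ler01.
move=> t tS.
have t0 : 0 < t by apply: lt_le_trans tS; exact: expR_gt0.
pose s := ln t / 2.
have lnt : ln t = 2 * s by rewrite /s mulrC divfK.
have : Num.max 1 S <= s.
  by rewrite /s ler_pdivlMr// mulrC -ler_expR (lnK t0).
rewrite ge_max => /andP[s1 Ss].
have s0 : 0 < s by apply: lt_le_trans s1.
apply: (le_trans (laplace_le_small_ball (expR (- s)) Y_pos (ltW t0))).
rewrite -fE -EFinD lee_fin.
have -> : - t * expR (- s) = - expR s.
  by rewrite mulNr -{1}(lnK t0) lnt -expRD; congr (- expR _); ring.
have sg : b' * s `^ gamma <= 2^-1 * expR s.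
  have : b' <= 2^-1 / gamma `^ gamma by rewrite ge_min lexx orbT.
  rewrite ler_pdivlMr// => b'g.
  apply: le_trans (_ : b' * (gamma `^ gamma * expR s) <= _).
    by rewrite ler_wpM2l ?(ltW b'0)//; exact: powR_le_expR.
  by rewrite mulrA ler_wpM2r// expR_ge0.
have es := expR_ge1Dx s.
set E := expR (- b' * s `^ gamma).
have fsE : f s <= 2^-1 * E.
  apply: (le_trans (fS _ Ss)).
  rewrite ler_wpM2l ?invr_ge0// ler_expR !mulNr lerN2 ler_wpM2r ?powR_ge0//.
  by rewrite ge_min lexx.
have eE : expR (- expR s) <= 2^-1 * E.
  have e1 : expR (- 1) <= 2^-1 :> R.
    rewrite expRN lef_pV2 ?posrE ?expR_gt0//; exact: (expR_ge1Dx (1 : R)).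
  apply: le_trans (_ : expR (- 1) * E <= _).
    rewrite -expRD ler_expR; lra.
  by rewrite ler_wpM2r// expR_ge0.
apply: (@le_trans _ _ E); first lra.
rewrite ler_expR !mulNr lerN2 /c' -mulrA ler_wpM2l ?(ltW b'0)//.
apply: le_trans (_ : 2^-1 `^ gamma * ln t `^ gamma <= _).
  rewrite ler_wpM2l ?powR_ge0// ler_powR ?(ltW alpha_gamma)//; lra.
by rewrite -powRM; [rewrite lnt mulrA mulVf// mul1r|rewrite invr_ge0|lra].
Qed.
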